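(* Let $n\ge 1$. For all $0\le i,j\le n$, $$U_n[i,j]=\sum_{\alpha\in Q^I_{j,i}}\ \prod_{r=i}^{j-1}t_{\alpha_{j-r},r+1}.$$
   Context: Let $t_{a,b}$ be real scalars for integers $0\le a<b$. Rows and columns of $(n+1)\times(n+1)$ matrices are indexed by $0,\dots,n$. Let $\mathcal{P}^{U_n}_{i,j}$ be the set of sequences of points $(k,y_k)$, $k=0,\dots,n$, with $y_k\in\{0,\dots,n\}$, $y_0=i$, $y_n=j$, $y_{k+1}\in\{y_k,y_k+1\}$ for $k<n$, and such that $y_{k+1}=y_k+1$ implies $y_k\ge k$. A rise step from $(k,y)$ to $(k+1,y+1)$ (with $y\neq n$) has weight $t_{y-k,y+1}$, and a horizontal step from $(k,y)$ to $(k+1,y)$ has weight $1$; the weight $\omega(p)$ of $p\in\mathcal{P}^{U_n}_{i,j}$ is the product of the weights of its steps. $U_n$ is the $(n+1)\times(n+1)$ matrix with $U_n[i,j]=\sum_{p\in\mathcal{P}^{U_n}_{i,j}}\omega(p)$. For $a>b$, $Q^I_{a,b}$ is the set of (weakly) increasing integer sequences $\alpha=(\alpha_1,\dots,\alpha_{a-b})$ of length $a-b$ with $0\le\alpha_r\le a-r$ for every $r$. Also $Q^I_{a,a}=\{\varepsilon\}$ where $\varepsilon$ is the empty sequence, and $Q^I_{a,b}=\emptyset$ for $a<b$. Empty products equal $1$ and empty sums equal $0$. *)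

(* Defs.v *)
From HB Require Import structures.
From mathcomp Require Import all_boot all_order all_algebra.
From mathcomp Require Import reals.

Set Implicit Arguments.
Unset Strict Implicit.
Unset Printing Implicit Defensive.

Import Order.TTheory GRing.Theory Num.Theory.
Local Open Scope ring_scope.

(* A sequence of points (k, y_k), 0 <= k <= n, with y_k in {0, ..., n}, is
   encoded by its heights k |-> y_k. For a step index k < n, the two ends of
   the step are the abscissas k and k + 1. *)
Definition heights (n : nat) := {ffun 'I_n.+1 -> 'I_n.+1}.

Definition step_src (n : nat) (y : heights n) (k : 'I_n) : nat :=
  y (widen_ord (leqnSn n) k).

Definition step_dst (n : nat) (y : heights n) (k : 'I_n) : nat :=
  y (lift ord0 k).

Definition U_step (k y y' : nat) : bool :=
  ((y' == y) || (y' == y.+1)) && ((y' == y.+1) ==> (k <= y)%N).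

Definition U_paths (n : nat) (i j : 'I_n.+1) : {set heights n} :=
  [set y : heights n | [&& y ord0 == i, y ord_max == j
     & [forall k : 'I_n, U_step k (step_src y k) (step_dst y k)]]].

(* t is total on nat * nat, but only its values t a b with a < b matter: a
   rise step of a path in U_paths satisfies k <= y, so that the subtraction
   y - k is not truncated and y - k < y + 1. *)
Definition step_weight (R : realType) (t : nat -> nat -> R) (k y y' : nat) : R :=
  if y' == y.+1 then t (y - k)%N y.+1 else 1.

Definition path_weight (R : realType) (t : nat -> nat -> R) (n : nat)
    (y : heights n) : R :=
  \prod_(k < n) step_weight t k (step_src y k) (step_dst y k).

Definition U (R : realType) (t : nat -> nat -> R) (n : nat) : 'M[R]_n.+1 :=
  \matrix_(i, j) \sum_(p in U_paths i j) path_weight t p.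

(* The entry alpha_r of a sequence (alpha_1, ..., alpha_m), numbered from 1. *)
Definition entry (a m : nat) (alpha : m.-tuple 'I_a) (r : nat) : nat :=
  nth 0%N (map val alpha) r.-1.

(* Since 0 <= alpha_r <= a - r <= a - 1 for r >= 1, the entries may be taken in
   'I_a. For a = b the only tuple is the empty one, also when a = 0; for a < b
   the length a - b is truncated to 0 and the set is emptied by b <= a. *)
Definition QI (a b : nat) : {set (a - b).-tuple 'I_a} :=
  [set alpha : (a - b).-tuple 'I_a |
    [&& (b <= a)%N, sorted leq (map val alpha)
      & [forall r : 'I_(a - b), (entry alpha r.+1 <= a - r.+1)%N]]].

(* Main.v *)
Require Import Defs.
From HB Require Import structures.
From mathcomp Require Import all_boot all_order all_algebra.
From mathcomp Require Import reals.
From mathcomp Require Import zify.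

Set Implicit Arguments.
Unset Strict Implicit.
Unset Printing Implicit Defensive.

Import Order.TTheory GRing.Theory Num.Theory.
Local Open Scope ring_scope.

(** A path climbs through each level r with i <= r < j exactly once, say at
    abscissa k_r. Put c_r = r - k_r: the rise at level r has weight
    t (c_r) (r + 1), and k_r <= r means 0 <= c_r. As the k_r increase strictly,
    the c_r decrease weakly; read downwards from r = j - 1 to r = i they form
    the increasing sequence alpha, with alpha_(j - r) = c_r. The bounds
    alpha_r <= j - r all follow from the one on the largest entry, c_i <= i.

    Rather than building this bijection, both sides are shown to obey the same
    recurrence. Cutting off the first step of a path at (k, y) leaves a path
    starting at (k + 1, y) or (k + 1, y + 1) ([path_sumS], [U_weight_sum]). On the
    side of decreasing sequences c_y >= c_(y+1) >= ... with c_y <= b, either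
    c_y <= b - 1, or c_y = b and the remaining entries are bounded by b
    ([chain_sum_succ]). The two rules agree for b = y - k, since
    y - (k + 1) = b - 1 and (y + 1) - (k + 1) = b; for b = 0 only the rise is left,
    since a path below the diagonal stays horizontal ([chain_sum_zero]). Hence the
    paths that start at (k, y) have the same total weight as the decreasing
    sequences bounded by y - k ([path_sum_tail_value]), and k = 0 is the theorem. *)

(** * Weighted paths in a finite set of states *)

Section PathSum.
Variables (R : realType) (T : finType).

(** The abscissas run from k to k + m, so that a tail of a path is again of this
    form. *)
Definition path_sum (w : nat -> T -> T -> R) (m k : nat) (x z : T) : R :=
  \sum_(f : {ffun 'I_m.+1 -> T} | (f ord0 == x) && (f ord_max == z))
    \prod_(s < m) w (k + s)%N (f (widen_ord (leqnSn m) s)) (f (lift ord0 s)).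

Lemma path_sum0 w k x z : path_sum w 0 k x z = (x == z)%:R.
Proof.
rewrite /path_sum (reindex (fun u : T => [ffun=> u] : {ffun 'I_1 -> T})) /=.
  under eq_bigl => u do rewrite !ffunE.
  under eq_bigr => u _ do rewrite big_ord0.
  have [<-|xz] := eqVneq x z.
    by under eq_bigl => u do rewrite andbb; rewrite big_pred1_eq.
  by rewrite big_pred0 // => u; case: eqP => //= ->; exact: negbTE.
exists (fun f : {ffun 'I_1 -> T} => f ord0) => [u _|f _]; first by rewrite ffunE.
by apply/ffunP => s; rewrite ffunE (ord1 s).
Qed.

Lemma path_sumS w m k x z :
  path_sum w m.+1 k x z = \sum_(x' : T) w k x x' * path_sum w m k.+1 x' z.
Proof.
pose consf (f : {ffun 'I_m.+1 -> T}) : {ffun 'I_m.+2 -> T} :=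
  [ffun s => if unlift ord0 s is Some s' then f s' else x].
have consf0 f : consf f ord0 = x by rewrite ffunE unlift_none.
have consfS f s : consf f (lift ord0 s) = f s by rewrite ffunE liftK.
pose tailf (f : {ffun 'I_m.+2 -> T}) : {ffun 'I_m.+1 -> T} :=
  [ffun s => f (lift ord0 s)].
have consfK f : tailf (consf f) = f by apply/ffunP => s; rewrite ffunE consfS.
have max_lift : ord_max = lift ord0 (@ord_max m) by apply: val_inj.
rewrite /path_sum (reindex_onto consf tailf) /=; last first.
  move=> f /andP[/eqP f0 _]; apply/ffunP => s; rewrite ffunE.
  by case: unliftP => [s'|] ->; rewrite ?ffunE.
under eq_bigl => f do rewrite consf0 consfK !eqxx andbT max_lift consfS.
rewrite (partition_big (fun f : {ffun 'I_m.+1 -> T} => f ord0) predT) //=.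
apply: eq_bigr => x' _; rewrite big_distrr /=.
under eq_bigl => f do rewrite andbC.
apply: eq_bigr => f /andP[/eqP f0 _]; rewrite big_ord_recl addn0.
congr (_ * _).
  rewrite consfS f0 -[in RHS](consf0 f).
  by congr (w _ (consf f _) _); apply: val_inj.
apply: eq_bigr => s _; rewrite consfS addSnnS.
by rewrite -[in RHS](consfS f); congr (w _ (consf f _) _); apply: val_inj.
Qed.

End PathSum.

(** * Weakly decreasing sequences *)

Section ChainSum.
Variables (R : realType) (t : nat -> nat -> R) (a : nat).

(** The sequence lists the values c_y, c_(y+1), ..., c_(y+m-1), with b bounding
    the first of them, hence all of them. The type 'I_a only makes the range of
    summation finite: the sum does not depend on a as long as b < a. *)
Definition chain_sum (m y b : nat) : R :=
  \sum_(c : m.-tuple 'I_a | path geq b (map val c))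
    \prod_(s < m) t (nth 0%N (map val c) s) (y + s).+1.

Lemma chain_sum0 y b : chain_sum 0 y b = 1.
Proof.
rewrite /chain_sum (big_pred1 [tuple]) => [|c]; first by rewrite big_ord0.
by rewrite (tuple0 c) /= eqxx.
Qed.

Lemma chain_sumS m y b : (b < a)%N ->
  chain_sum m.+1 y b = \sum_(0 <= d < b.+1) t d y.+1 * chain_sum m y.+1 d.
Proof.
move=> ba; rewrite big_mkord.
rewrite (big_ord_widen a (fun d => t d y.+1 * chain_sum m y.+1 d)) //.
rewrite /chain_sum.
rewrite (partition_big (fun c : m.+1.-tuple 'I_a => thead c)
  (fun d : 'I_a => d < b.+1)%N) /=; last first.
  by move=> c; rewrite [c]tuple_eta theadE /= => /andP[].
apply: eq_bigr => d db; rewrite big_distrr /=.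
rewrite (reindex_onto (fun c : m.-tuple 'I_a => [tuple of d :: c])
  (fun c : m.+1.-tuple 'I_a => [tuple of behead c])) /=; last first.
  by move=> c /andP[_ /eqP <-]; rewrite [c in RHS]tuple_eta.
apply: eq_big => [c|c _].
  rewrite theadE eqxx andbT (_ : (d <= b)%N) //=.
  by rewrite (_ : [tuple of _] = c) ?eqxx ?andbT //; apply: val_inj.
rewrite big_ord_recl /= addn0; congr (_ * _).
by apply: eq_bigr => s _; rewrite /= addSnnS.
Qed.

Lemma chain_sum_zero m y : (0 < a)%N ->
  chain_sum m.+1 y 0 = t 0%N y.+1 * chain_sum m y.+1 0.
Proof. by move=> a0; rewrite chain_sumS // big_nat1. Qed.

Lemma chain_sum_succ m y b : (b.+1 < a)%N ->
  chain_sum m.+1 y b.+1 =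
    chain_sum m.+1 y b + t b.+1 y.+1 * chain_sum m y.+1 b.+1.
Proof.
move=> ba; have ba' := ltnW ba.
by rewrite (chain_sumS m y ba) (chain_sumS m y ba') big_nat_recr.
Qed.

End ChainSum.

(** * The common recurrence *)

Section Recurrence.
Variables (R : realType) (t : nat -> nat -> R) (n : nat).

Definition U_weight (k y y' : nat) : R :=
  if U_step k y y' then step_weight t k y y' else 0.

(** Giving weight 0 to the forbidden steps turns the restricted sum into a sum over
    all sequences of heights with the given ends. *)
Lemma U_path_sum (i j : 'I_n.+1) :
  U t n i j = path_sum (fun k (x x' : 'I_n.+1) => U_weight k x x') n 0 i j.
Proof.
rewrite mxE /path_sum [LHS]big_mkcond [RHS]big_mkcond /=.
apply: eq_bigr => f _; rewrite inE.
case: (f ord0 == i) => //=; case: (f ord_max == j) => //=.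
case: ifPn => [/forallP ok|].
  by apply: eq_bigr => s _; rewrite /U_weight ok.
rewrite negb_forall => /existsP[s /negbTE bad].
by rewrite (bigD1 s) //= /U_weight -/(step_src f s) -/(step_dst f s) bad mul0r.
Qed.

(** From height n a rise would leave the grid; the hypothesis on g makes the
    formula hold there too. *)
Lemma U_weight_sum (g : nat -> R) k (x : 'I_n.+1) : g n.+1 = 0 ->
  \sum_(x' < n.+1) U_weight k x x' * g x' =
    g x + (if (k <= x)%N then t (x - k)%N x.+1 * g x.+1 else 0).
Proof.
move=> gn.
have -> : \sum_(x' < n.+1) U_weight k x x' * g x' =
          \sum_(x' < n.+2) U_weight k x x' * g x'.
  by rewrite [RHS]big_ord_recr /= gn mulr0 addr0.
rewrite (bigD1 (widen_ord (leqnSn _) x)) //= (bigD1 (lift ord0 x)) /=; last first.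
  by rewrite -val_eqE /= /bump /=; lia.
rewrite big1 ?addr0 => [|x' /andP[]]; last first.
  rewrite -!val_eqE /= /bump /= add1n /U_weight /U_step.
  by move=> /negbTE -> /negbTE ->; rewrite mul0r.
rewrite /bump add1n /U_weight /U_step /step_weight !eqxx orbT /=.
rewrite (_ : (x == x.+1 :> nat) = false) /= ?mul1r; last by lia.
by case: ifP => _; rewrite ?mul0r.
Qed.

(** Closed form for the paths from (k, y) to height j. Below the diagonal, for
    y < k, only horizontal steps remain. *)
Definition tail_value (j k y : nat) : R :=
  if (k <= y <= j)%N then chain_sum t j (j - y) y (y - k) else (y == j)%:R.

Lemma tail_value_step j k y :
  tail_value j k y = tail_value j k.+1 y +
    (if (k <= y)%N then t (y - k)%N y.+1 * tail_value j k.+1 y.+1 else 0).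
Proof.
rewrite /tail_value; case: (leqP k y) => /= [ky|yk]; last first.
  by rewrite (leqNgt k.+1) ltnS (ltnW yk) /= addr0.
rewrite subSS ltnS ky /=; case: (ltngtP y j) => /= [yj|jy|<-].
- have -> : (j - y = (j - y.+1).+1)%N by lia.
  case: (ltnP k y) => [ky1|yk] /=.
    have -> : (y - k = (y - k.+1).+1)%N by lia.
    by rewrite chain_sum_succ //; lia.
  by rewrite (_ : (y - k = 0)%N) ?add0r ?chain_sum_zero //; lia.
- by rewrite andbF (_ : (y.+1 == j) = false) ?mulr0 ?addr0 //; lia.
rewrite subnn !chain_sum0 (_ : (y.+1 == y) = false) ?mulr0 ?addr0; last by lia.
by case: ifP.
Qed.

Lemma path_sum_tail_value (j : 'I_n.+1) m k (x : 'I_n.+1) : (m + k = n)%N ->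
  path_sum (fun k (x x' : 'I_n.+1) => U_weight k x x') m k x j
    = tail_value j k x.
Proof.
elim: m k x => [|m IHm] k x mk.
  rewrite path_sum0 /tail_value -val_eqE /=; case: ifP => // /andP[kx xj].
  have -> : x = j :> nat by have := ltn_ord j; lia.
  by rewrite eqxx subnn chain_sum0.
rewrite path_sumS tail_value_step -U_weight_sum; last first.
  by rewrite /tail_value [(n < j)%N]leqNgt ltn_ord andbF gtn_eqF.
by apply: eq_bigr => x' _; rewrite IHm // addnS -addSn.
Qed.

End Recurrence.

(** * Increasing sequences as reversed decreasing ones *)

(** The first bound on the reversed sequence, alpha_(j - i) <= i, implies the
    other ones because the sequence is increasing. *)
Lemma mem_QI_rev (j i : nat) (alpha : (j - i).-tuple 'I_j) : (i <= j)%N ->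
  (alpha \in QI j i) = path geq i (rev (map val alpha)).
Proof.
move=> ij; rewrite inE ij /=.
set s := map val alpha.
have sz : size s = (j - i)%N by rewrite size_map size_tuple.
have geq_trans : transitive geq by move=> ? ? ? /= ? ?; lia.
rewrite (path_sortedE geq_trans) rev_sorted andbC all_rev.
apply: andb_id2r => srt.
apply/forallP/allP => /= [bnd d /(nthP 0%N)[r rs <-]|bnd r].
  rewrite sz in rs.
  have lt_last : ((j - i).-1 < j - i)%N by lia.
  have := bnd (Ordinal lt_last); rewrite /entry /= -/s => le_last.
  have := sorted_leq_nth leq_trans leqnn 0%N srt.
  move=> /(_ r (j - i).-1); rewrite !inE sz => s_mono.
  by apply: leq_trans (s_mono _ _ _) _; lia.
have := bnd (nth 0%N s r); rewrite mem_nth ?sz // /entry /= -/s => /(_ isT).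
by have := ltn_ord r; lia.
Qed.

Lemma QI_chain_sum (R : realType) (t : nat -> nat -> R) (j i : nat) :
  (i <= j)%N ->
  \sum_(alpha in QI j i) \prod_(i <= r < j) t (entry alpha (j - r)%N) r.+1
    = chain_sum t j (j - i) i i.
Proof.
move=> ij; rewrite /chain_sum.
pose rev_tuple (c : (j - i).-tuple 'I_j) := [tuple of rev c].
have rev_tupleK : involutive rev_tuple.
  by move=> c; apply: val_inj; rewrite /= revK.
rewrite (reindex_inj (inv_inj rev_tupleK)) /=.
apply: eq_big => [c|c _]; first by rewrite mem_QI_rev //= map_rev revK.
rewrite -{1}[i]add0n big_addn big_mkord; apply: eq_bigr => s _.
rewrite /entry /= map_rev nth_rev size_map size_tuple; last by have := ltn_ord s; lia.
by congr (t (nth _ _ _) _); have := ltn_ord s; lia.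
Qed.

Theorem theorem3p5 (R : realType) (t : nat -> nat -> R) (n : nat)
    (hn : (1 <= n)%N) (i j : 'I_n.+1) :
  U t n i j =
  \sum_(alpha in QI j i) \prod_(i <= r < j) t (entry alpha (j - r)%N) r.+1.
Proof.
rewrite U_path_sum path_sum_tail_value ?addn0 // /tail_value /= subn0.
case: leqP => [ij|ji]; first by rewrite QI_chain_sum.
rewrite big_pred0 => [|alpha]; first by rewrite gtn_eqF.
by rewrite inE leqNgt ji.
Qed.
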